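(* Let $P$ be an arbitrary set, let $\mathcal{LS}$ be the category of the monoidal monad (with $\psi^L$ and $\psi^R$ primitive) freely generated by $P$ as set of generating objects, and let $\mathit{Fun}$ be the category of all functions between finite ordinals. Then the functor $G:\mathcal{LS}\to\mathit{Fun}$ defined in the context is faithful; i.e. for all objects $A,B$ and all arrows $f,g:A\to B$ of $\mathcal{LS}$, if $Gf=Gg$, then $f=g$.
   Context: A monoidal category has a bifunctor $\otimes$, a unit object $I$ and natural isomorphisms $a_{A,B,C}:(A\otimes B)\otimes C\to A\otimes(B\otimes C)$, $l_A:I\otimes A\to A$, $r_A:A\otimes I\to A$ satisfying the usual coherence conditions. $\mathbf 1_A$ denotes the identity arrow of $A$. A monoidal monad in a monoidal category $\mathcal A$ is a monad $\langle T,\eta,\mu\rangle$ in $\mathcal A$ (with $\eta_A:A\to TA$, $\mu_A:TTA\to TA$) together with natural transformations with components $\psi^L_{A,B}:TA\otimes B\to T(A\otimes B)$ and $\psi^R_{A,B}:A\otimes TB\to T(A\otimes B)$ such that - $Ta_{A,B,C}\circ\psi^L_{A\otimes B,C}\circ(\psi^L_{A,B}\otimes\mathbf 1_C)=\psi^L_{A,B\otimes C}\circ a_{TA,B,C}$, - $Tr_A\circ\psi^L_{A,I}=r_{TA}$, - $Ta_{A,B,C}\circ\psi^R_{A\otimes B,C}=\psi^R_{A,B\otimes C}\circ(\mathbf 1_A\otimes\psi^R_{B,C})\circ a_{A,B,TC}$, - $Tl_A\circ\psi^R_{I,A}=l_{TA}$, - $Ta_{A,B,C}\circ\psi^L_{A\otimes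 B,C}\circ(\psi^R_{A,B}\otimes\mathbf 1_C)=\psi^R_{A,B\otimes C}\circ(\mathbf 1_A\otimes\psi^L_{B,C})\circ a_{A,TB,C}$, - $\psi^L_{A,B}\circ(\eta_A\otimes\mathbf 1_B)=\eta_{A\otimes B}$ and $\psi^R_{A,B}\circ(\mathbf 1_A\otimes\eta_B)=\eta_{A\otimes B}$, - $\psi^L_{A,B}\circ(\mu_A\otimes\mathbf 1_B)=\mu_{A\otimes B}\circ T\psi^L_{A,B}\circ\psi^L_{TA,B}$, - $\psi^R_{A,B}\circ(\mathbf 1_A\otimes\mu_B)=\mu_{A\otimes B}\circ T\psi^R_{A,B}\circ\psi^R_{A,TB}$, - $\mu_{A\otimes B}\circ T\psi^L_{A,B}\circ\psi^R_{TA,B}=\mu_{A\otimes B}\circ T\psi^R_{A,B}\circ\psi^L_{A,TB}:TA\otimes TB\to T(A\otimes B)$. $\mathcal{LS}$ is the free such structure on $P$: its objects are the formal expressions built from elements of $P$ and $I$ by $\otimes$ and $T$; its arrows are arrow terms built from identities, $a,a^{-1},l,l^{-1},r,r^{-1},\eta,\mu,\psi^L,\psi^R$ by $\circ$, $\otimes$ and $T$, modulo the congruence generated by the equations of categories, functoriality, naturality, monoidal categories, monads, and the equations above. $\mathit{Fun}$ has as objects the finite ordinals $n=\{0,\dots,n-1\}$ and as arrows arbitrary functions between them. The functor $G$: $GA$ is the number of occurrences of $T$ in $A$; the elements $0,\dots,GA-1$ of $GA$ correspond to the occurrences of $T$ in $A$ counted from right to left. On arrow terms: $G$ of an identity, of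 $a_{A,B,C}$, $l_A$, $r_A$ and their inverses, and of $\psi^L_{A,B}$ is the identity function; $G\psi^R_{A,B}$ is the bijection that sends the occurrence of $T$ immediately in front of $B$ in the source $A\otimes TB$ to the outermost (leftmost) occurrence of $T$ in the target $T(A\otimes B)$, and sends every occurrence of $T$ inside $A$, respectively inside $B$, to the corresponding occurrence inside $A$, respectively $B$; $G\eta_A:GA\to GA+1$ is $i\mapsto i$; $G\mu_A:GA+2\to GA+1$ is $i\mapsto i$ for $i\le GA$ and $GA+1\mapsto GA$; $G(f\otimes g)$ is the juxtaposition of $Gf$ (on the left, i.e. on the larger elements) and $Gg$ (on the right, i.e. on the smaller elements); $GTf$ extends $Gf$ by sending the new leftmost (greatest) element of the source to the new leftmost (greatest) element of the target; $G(g\circ f)=Gg\circ Gf$. *)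

(* Defs.v *)
From mathcomp Require Import all_boot.
From mathcomp Require Import zify.
From Corelib Require Import RelationClasses.

Set Implicit Arguments.
Unset Strict Implicit.
Unset Printing Implicit Defensive.

(* Every hom-type carries an equivalence relation [heq], which plays the role
   of equality of arrows; a category of terms modulo a congruence is thus
   represented without forming quotient types. *)
Record category : Type := Category {
  ob :> Type;
  hom : ob -> ob -> Type;
  heq : forall A B : ob, hom A B -> hom A B -> Prop;
  idn : forall A : ob, hom A A;
  comp : forall A B C : ob, hom B C -> hom A B -> hom A C;
  heq_equiv : forall A B : ob, Equivalence (@heq A B);
  comp_heq : forall (A B C : ob) (g g' : hom B C) (f f' : hom A B),
    heq g g' -> heq f f' -> heq (comp g f) (comp g' f');
  comp_idl : forall (A B : ob) (f : hom A B), heq (comp (idn B) f) f;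
  comp_idr : forall (A B : ob) (f : hom A B), heq (comp f (idn A)) f;
  compA : forall (A B C D : ob) (h : hom C D) (g : hom B C) (f : hom A B),
    heq (comp h (comp g f)) (comp (comp h g) f)
}.

Record functor (C D : category) : Type := Functor {
  fob :> C -> D;
  fmap : forall A B : C, hom A B -> hom (fob A) (fob B);
  fmap_heq : forall (A B : C) (f g : hom A B),
    heq f g -> heq (fmap f) (fmap g);
  fmap_id : forall A : C, heq (fmap (idn A)) (idn (fob A));
  fmap_comp : forall (A B E : C) (g : hom B E) (f : hom A B),
    heq (fmap (comp g f)) (comp (fmap g) (fmap f))
}.

Definition faithful (C D : category) (F : functor C D) : Prop :=
  forall (A B : C) (f g : hom A B), heq (fmap F f) (fmap F g) -> heq f g.

Section FreeMonoidalMonad.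

Variable P : Type.

Inductive obj : Type :=
  | Gen of P
  | Unit
  | Tensor of obj & obj
  | Tob of obj.

Local Notation I := Unit.
Local Notation T := Tob.
Local Infix "⊗" := Tensor (at level 40, left associativity).

Inductive arr : obj -> obj -> Type :=
  | Id A : arr A A
  | Comp A B C : arr B C -> arr A B -> arr A C
  | Tens A A' B B' : arr A A' -> arr B B' -> arr (A ⊗ B) (A' ⊗ B')
  | Tarr A B : arr A B -> arr (T A) (T B)
  | Assoc A B C : arr ((A ⊗ B) ⊗ C) (A ⊗ (B ⊗ C))
  | AssocV A B C : arr (A ⊗ (B ⊗ C)) ((A ⊗ B) ⊗ C)
  | Lunit A : arr (I ⊗ A) A
  | LunitV A : arr A (I ⊗ A)
  | Runit A : arr (A ⊗ I) A
  | RunitV A : arr A (A ⊗ I)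
  | Eta A : arr A (T A)
  | Mu A : arr (T (T A)) (T A)
  | PsiL A B : arr (T A ⊗ B) (T (A ⊗ B))
  | PsiR A B : arr (A ⊗ T B) (T (A ⊗ B)).

Local Infix "∘" := Comp (at level 45, right associativity).
Local Infix "⊗₁" := Tens (at level 40, left associativity).

Reserved Notation "f ≡ g" (at level 70, no associativity).

(* Naturality of the inverses [AssocV], [LunitV], [RunitV] is derivable. *)
Inductive arr_eq : forall A B : obj, arr A B -> arr A B -> Prop :=
  (* congruence *)
  | arr_refl A B (f : arr A B) : f ≡ f
  | arr_sym A B (f g : arr A B) : f ≡ g -> g ≡ f
  | arr_trans A B (f g h : arr A B) : f ≡ g -> g ≡ h -> f ≡ h
  | arr_comp A B C (g g' : arr B C) (f f' : arr A B) :
      g ≡ g' -> f ≡ f' -> g ∘ f ≡ g' ∘ f'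
  | arr_tens A A' B B' (f f' : arr A A') (g g' : arr B B') :
      f ≡ f' -> g ≡ g' -> f ⊗₁ g ≡ f' ⊗₁ g'
  | arr_T A B (f f' : arr A B) : f ≡ f' -> Tarr f ≡ Tarr f'
  (* category *)
  | cat_idl A B (f : arr A B) : Id B ∘ f ≡ f
  | cat_idr A B (f : arr A B) : f ∘ Id A ≡ f
  | cat_assoc A B C D (h : arr C D) (g : arr B C) (f : arr A B) :
      h ∘ (g ∘ f) ≡ (h ∘ g) ∘ f
  (* functoriality *)
  | tens_id A B : Id A ⊗₁ Id B ≡ Id (A ⊗ B)
  | tens_comp A B C A' B' C' (g : arr B C) (f : arr A B)
      (g' : arr B' C') (f' : arr A' B') :
      (g ∘ f) ⊗₁ (g' ∘ f') ≡ (g ⊗₁ g') ∘ (f ⊗₁ f')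
  | T_id A : Tarr (Id A) ≡ Id (T A)
  | T_comp A B C (g : arr B C) (f : arr A B) :
      Tarr (g ∘ f) ≡ Tarr g ∘ Tarr f
  (* naturality *)
  | assoc_nat A A' B B' C C' (f : arr A A') (g : arr B B') (h : arr C C') :
      Assoc A' B' C' ∘ ((f ⊗₁ g) ⊗₁ h) ≡ (f ⊗₁ (g ⊗₁ h)) ∘ Assoc A B C
  | lunit_nat A A' (f : arr A A') :
      Lunit A' ∘ (Id I ⊗₁ f) ≡ f ∘ Lunit A
  | runit_nat A A' (f : arr A A') :
      Runit A' ∘ (f ⊗₁ Id I) ≡ f ∘ Runit A
  | eta_nat A A' (f : arr A A') : Eta A' ∘ f ≡ Tarr f ∘ Eta A
  | mu_nat A A' (f : arr A A') : Mu A' ∘ Tarr (Tarr f) ≡ Tarr f ∘ Mu A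
  | psiL_nat A A' B B' (f : arr A A') (g : arr B B') :
      PsiL A' B' ∘ (Tarr f ⊗₁ g) ≡ Tarr (f ⊗₁ g) ∘ PsiL A B
  | psiR_nat A A' B B' (f : arr A A') (g : arr B B') :
      PsiR A' B' ∘ (f ⊗₁ Tarr g) ≡ Tarr (f ⊗₁ g) ∘ PsiR A B
  (* monoidal category *)
  | assocK A B C : AssocV A B C ∘ Assoc A B C ≡ Id _
  | assocVK A B C : Assoc A B C ∘ AssocV A B C ≡ Id _
  | lunitK A : LunitV A ∘ Lunit A ≡ Id _
  | lunitVK A : Lunit A ∘ LunitV A ≡ Id _
  | runitK A : RunitV A ∘ Runit A ≡ Id _
  | runitVK A : Runit A ∘ RunitV A ≡ Id _
  | pentagon A B C D :
      Assoc A B (C ⊗ D) ∘ Assoc (A ⊗ B) C D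
      ≡ (Id A ⊗₁ Assoc B C D) ∘ Assoc A (B ⊗ C) D ∘ (Assoc A B C ⊗₁ Id D)
  | triangle A B :
      (Id A ⊗₁ Lunit B) ∘ Assoc A I B ≡ Runit A ⊗₁ Id B
  (* monad *)
  | mu_assoc A : Mu A ∘ Tarr (Mu A) ≡ Mu A ∘ Mu (T A)
  | mu_etaT A : Mu A ∘ Eta (T A) ≡ Id (T A)
  | mu_Teta A : Mu A ∘ Tarr (Eta A) ≡ Id (T A)
  (* monoidal monad *)
  | psiL_assoc A B C :
      Tarr (Assoc A B C) ∘ PsiL (A ⊗ B) C ∘ (PsiL A B ⊗₁ Id C)
      ≡ PsiL A (B ⊗ C) ∘ Assoc (T A) B C
  | psiL_runit A : Tarr (Runit A) ∘ PsiL A I ≡ Runit (T A)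
  | psiR_assoc A B C :
      Tarr (Assoc A B C) ∘ PsiR (A ⊗ B) C
      ≡ PsiR A (B ⊗ C) ∘ (Id A ⊗₁ PsiR B C) ∘ Assoc A B (T C)
  | psiR_lunit A : Tarr (Lunit A) ∘ PsiR I A ≡ Lunit (T A)
  | psiLR_assoc A B C :
      Tarr (Assoc A B C) ∘ PsiL (A ⊗ B) C ∘ (PsiR A B ⊗₁ Id C)
      ≡ PsiR A (B ⊗ C) ∘ (Id A ⊗₁ PsiL B C) ∘ Assoc A (T B) C
  | psiL_eta A B : PsiL A B ∘ (Eta A ⊗₁ Id B) ≡ Eta (A ⊗ B)
  | psiR_eta A B : PsiR A B ∘ (Id A ⊗₁ Eta B) ≡ Eta (A ⊗ B)
  | psiL_mu A B :
      PsiL A B ∘ (Mu A ⊗₁ Id B)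
      ≡ Mu (A ⊗ B) ∘ Tarr (PsiL A B) ∘ PsiL (T A) B
  | psiR_mu A B :
      PsiR A B ∘ (Id A ⊗₁ Mu B)
      ≡ Mu (A ⊗ B) ∘ Tarr (PsiR A B) ∘ PsiR A (T B)
  | psiL_psiR A B :
      Mu (A ⊗ B) ∘ Tarr (PsiL A B) ∘ PsiR (T A) B
      ≡ Mu (A ⊗ B) ∘ Tarr (PsiR A B) ∘ PsiL A (T B)
where "f ≡ g" := (@arr_eq _ _ f g).

Lemma arr_eq_equiv A B : Equivalence (@arr_eq A B).
Proof.
split; [exact: arr_refl | exact: arr_sym |].
by move=> f g h; exact: arr_trans.
Qed.

Definition LS : category :=
  Category arr_eq_equiv arr_comp cat_idl cat_idr cat_assoc.

End FreeMonoidalMonad.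

Section FinOrd.

Implicit Types m n p : nat.

Definition fun_id n : {ffun 'I_n -> 'I_n} := [ffun i => i].

Definition fun_comp m n p (g : {ffun 'I_n -> 'I_p}) (f : {ffun 'I_m -> 'I_n}) :
  {ffun 'I_m -> 'I_p} := [ffun i => g (f i)].

Lemma fun_comp_eq m n p (g g' : {ffun 'I_n -> 'I_p})
  (f f' : {ffun 'I_m -> 'I_n}) :
  g = g' -> f = f' -> fun_comp g f = fun_comp g' f'.
Proof. by move=> -> ->. Qed.

Lemma fun_idl m n (f : {ffun 'I_m -> 'I_n}) : fun_comp (fun_id n) f = f.
Proof. by apply/ffunP=> i; rewrite !ffunE. Qed.

Lemma fun_idr m n (f : {ffun 'I_m -> 'I_n}) : fun_comp f (fun_id m) = f.
Proof. by apply/ffunP=> i; rewrite !ffunE. Qed.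

Lemma fun_compA m n p q (h : {ffun 'I_p -> 'I_q}) (g : {ffun 'I_n -> 'I_p})
  (f : {ffun 'I_m -> 'I_n}) :
  fun_comp h (fun_comp g f) = fun_comp (fun_comp h g) f.
Proof. by apply/ffunP=> i; rewrite !ffunE. Qed.

Definition Fun : category :=
  @Category nat (fun m n => {ffun 'I_m -> 'I_n}) (fun m n => @eq _)
    fun_id fun_comp (fun m n => eq_equivalence) fun_comp_eq
    fun_idl fun_idr fun_compA.

(* The identity function, between two provably equal ordinals. *)
Definition fun_cast m n (e : m = n) : {ffun 'I_m -> 'I_n} :=
  [ffun i => cast_ord e i].

(* [f] acts on the larger elements, [g] on the smaller ones. *)
Definition fun_juxt m1 n1 m2 n2 (f : {ffun 'I_m1 -> 'I_n1})
  (g : {ffun 'I_m2 -> 'I_n2}) : {ffun 'I_(m2 + m1) -> 'I_(n2 + n1)} :=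
  [ffun i => match split i with
             | inl j => lshift n1 (g j)
             | inr k => rshift n2 (f k)
             end].

(* [lift ord_max] is the value-preserving injection of 'I_n into 'I_n.+1. *)
Definition fun_top m n (f : {ffun 'I_m -> 'I_n}) : {ffun 'I_m.+1 -> 'I_n.+1} :=
  [ffun i => if unlift ord_max i is Some j then lift ord_max (f j)
             else ord_max].

Definition fun_eta n : {ffun 'I_n -> 'I_n.+1} := [ffun i => lift ord_max i].

Definition fun_mu n : {ffun 'I_n.+2 -> 'I_n.+1} :=
  [ffun i : 'I_n.+2 => inord (minn i n)].

(* For GB = m and GA = n: the source A ⊗ TB consists of the occurrences in B,
   the one in front of B, and those in A, in increasing order. *)
Definition fun_psiR m n : {ffun 'I_(m.+1 + n) -> 'I_(m + n).+1} :=
  [ffun i => match split i with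
             | inl j => if unlift ord_max j is Some k
                        then lift ord_max (lshift n k) else ord_max
             | inr k => lift ord_max (rshift m k)
             end].

End FinOrd.

Section FunctorG.

Variable P : Type.

(* Occurrences are counted from right to left, hence the order of the sum. *)
Fixpoint Gob (A : obj P) : nat :=
  match A with
  | Gen _ => 0
  | Unit => 0
  | Tensor A B => Gob B + Gob A
  | Tob A => (Gob A).+1
  end.

Fixpoint Garr (A B : obj P) (f : arr A B) : {ffun 'I_(Gob A) -> 'I_(Gob B)} :=
  match f in arr A B return {ffun 'I_(Gob A) -> 'I_(Gob B)} with
  | Id A => fun_id (Gob A)
  | Comp _ _ _ g f => fun_comp (Garr g) (Garr f)
  | Tens _ _ _ _ f g => fun_juxt (Garr f) (Garr g)
  | Tarr _ _ f => fun_top (Garr f)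
  | Assoc A B C => fun_cast (addnA (Gob C) (Gob B) (Gob A))
  | AssocV A B C => fun_cast (esym (addnA (Gob C) (Gob B) (Gob A)))
  | Lunit A => fun_cast (addn0 (Gob A))
  | LunitV A => fun_cast (esym (addn0 (Gob A)))
  | Runit A => fun_cast (add0n (Gob A))
  | RunitV A => fun_cast (esym (add0n (Gob A)))
  | Eta A => fun_eta (Gob A)
  | Mu A => fun_mu (Gob A)
  | PsiL A B => fun_cast (addnS (Gob B) (Gob A))
  | PsiR A B => fun_psiR (Gob B) (Gob A)
  end.

Lemma val_lift_max n (j : 'I_n) : lift ord_max j = j :> nat.
Proof. by rewrite /= /bump leqNgt ltn_ord. Qed.

(* [Garr] on the underlying natural numbers. *)
Fixpoint Gval (A B : obj P) (f : arr A B) (i : nat) : nat :=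
  match f with
  | Comp _ _ _ g f => Gval g (Gval f i)
  | @Tens _ _ _ B B' f g =>
      if i < Gob B then Gval g i else Gob B' + Gval f (i - Gob B)
  | @Tarr _ A B f => if i < Gob A then Gval f i else Gob B
  | Mu A => if i <= Gob A then i else Gob A
  | PsiR A B =>
      if i < Gob B then i else if i == Gob B then Gob B + Gob A else i.-1
  | _ => i
  end.

Lemma val_Garr (A B : obj P) (f : arr A B) (i : 'I_(Gob A)) :
  Garr f i = Gval f i :> nat.
Proof.
elim: f i => //=; try by move=> *; rewrite ffunE.
- by move=> A0 B0 C g IHg f IHf i; rewrite ffunE IHg IHf.
- move=> A1 A2 B1 B2 f IHf g IHg i; rewrite ffunE.
  by case: splitP => j /= ->; rewrite ?IHg // addKn IHf.
- move=> A1 B1 f IHf i; rewrite ffunE.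
  case: unliftP => [j|] ->; last by rewrite ltnn.
  by rewrite !val_lift_max ltn_ord IHf.
- by move=> A1 i; rewrite ffunE val_lift_max.
- move=> A1 i; rewrite ffunE inordK ?ltnS ?geq_minr //.
  by case: leqP.
- move=> A1 B1 i; rewrite ffunE; case: splitP => j /= ->.
    case: unliftP => [k|] ->; last by rewrite /= ltnn eqxx.
    by rewrite !val_lift_max ltn_ord.
  have ltj := ltn_ord j; rewrite /bump leqNgt ltn_add2l ltj add0n.
  by do !case: ifP; lia.
Qed.

Lemma Gval_lt (A B : obj P) (f : arr A B) i : i < Gob A -> Gval f i < Gob B.
Proof. by move=> h; rewrite -[i]/(val (Ordinal h)) -val_Garr. Qed.

Lemma Garr_eqP (A B : obj P) (f g : arr A B) :
  (forall i, i < Gob A -> Gval f i = Gval g i) <-> Garr f = Garr g.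
Proof.
split=> [efg | efg i h].
  by apply/ffunP=> i; apply/val_inj; rewrite /= !val_Garr efg.
by rewrite -[i]/(val (Ordinal h)) -!val_Garr efg.
Qed.

Local Ltac split_ifs := repeat match goal with
  | |- context [if ?b then _ else _] =>
    lazymatch b with context [if _ then _ else _] => fail | _ => idtac end;
    let h := fresh "h" in case h : b
  end.

Lemma Garr_heq (A B : obj P) (f g : arr A B) :
  arr_eq f g -> Garr f = Garr g.
Proof.
move=> efg; apply/Garr_eqP.
elim: {A B f g}efg => //=; try by move=> *; split_ifs; lia.
- by move=> A B f g _ IH i /IH.
- by move=> A B f g h _ IH1 _ IH2 i lti; rewrite IH1 ?IH2.
- by move=> A B C g g' f f' _ IHg _ IHf i lti; rewrite IHg ?IHf ?Gval_lt.
- move=> A A' B B' f f' g g' _ IHf _ IHg i lti.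
  by case: ltnP => [/IHg //|leBi]; rewrite IHf //; lia.
- by move=> A B f f' _ IH i _; case: ltnP => // /IH.
- move=> A B C A' B' C' g f g' f' i lti.
  by case: ltnP => [/Gval_lt -> //|_]; rewrite ltnNge leq_addr addKn.
- move=> A B C g f i _.
  by case: ltnP => [/Gval_lt -> //|_]; rewrite ltnn.
- move=> A A' B B' C C' f g h i lti; split_ifs; rewrite ?subnDA ?addnA; lia.
- by move=> A A' f i _; rewrite !add0n subn0.
- move=> A A' f i lti; case: (ltnP i (Gob A)) => [lt_iA|le_Ai].
    by have ? := Gval_lt f lt_iA; split_ifs; lia.
  by split_ifs; lia.
- move=> A A' B B' f g i lti; case: (ltnP i (Gob B)) => [lt_iB|le_Bi].
    by have ? := Gval_lt g lt_iB; split_ifs; lia.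
  case: (ltnP (Gob B) i) => [lt_Bi|le_iB]; last by split_ifs; lia.
  have lt_i : i.-1 - Gob B < Gob A by lia.
  have ? := Gval_lt f lt_i.
  have -> : i - (Gob B).+1 = i.-1 - Gob B by lia.
  by split_ifs; lia.
Qed.

Definition G : functor (LS P) Fun :=
  @Functor (LS P) Fun Gob Garr Garr_heq
    (fun A => erefl) (fun A B E g f => erefl).

End FunctorG.

(* Main.v *)
From mathcomp Require Import all_boot.
From mathcomp Require Import zify.
From Corelib Require Import RelationClasses.
From Stdlib Require Import Setoid Morphisms Eqdep.
Require Import Defs.

(** Two arrows with the same image under G are shown to be equal by induction
    on their common target: an arrow into each kind of target has a normal
    form, and G determines it.

    An arrow [f] into [T B] collects some of the occurrences of T of its source
    into the outermost T of the target, and then acts below it. The occurrences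
    collected form a set closed under passing to an occurrence further outside,
    and for each such set [m] there is a canonical arrow [collect m] from [A] to
    [T (erase m)], where [erase m] is [A] without the occurrences in [m]. It is
    built from the unit, the multiplication and the map [psi] from [T A ⊗ T B]
    to [T (A ⊗ B)], on whose associativity ([psi_assoc]) everything rests. By
    naturality of [collect] in [A] ([collect_nat]), [f] is [Tarr g ∘ collect m]
    for some [g] ([factor_collect]). The set [m] is the preimage of the
    greatest element under G of [f], and G of [g] is the restriction of G of
    [f], so induction applies to [g].

    An arrow [f] into [B ⊗ C] is a tensor product of an arrow into [B] and one
    into [C], preceded by a canonical isomorphism that cuts the source in two
    ([arr_tensor]). Again this is a naturality statement: a cut of the target
    of any arrow pulls back to its source ([cut_nat]). The cut is determined,
    up to isomorphisms of the two factors, by the number of generators and of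
    occurrences of T on its left ([split_equiv_weight]). The former is that
    of [B], as arrows preserve generators, and the latter is visible in G of
    [f].

    Finally, all arrows into the unit object with the same source are equal,
    and so are those into a generator. This is coherence for monoidal
    categories in a simple case: a canonical arrow to such a target is natural
    in its source ([to_unit_nat], [to_gen_nat]). *)

Set Implicit Arguments.
Unset Strict Implicit.
Unset Printing Implicit Defensive.

Section Faithful.

Variable P : Type.

Local Notation obj := (obj P).
Local Notation I := (Unit P).
Local Notation T := Tob.
Local Infix "⊗" := Tensor (at level 40, left associativity).
Local Infix "∘" := Comp (at level 45, right associativity).
Local Infix "⊗₁" := Tens (at level 40, left associativity).
Local Notation "f ≡ g" := (arr_eq f g) (at level 70, no associativity).

(** * Rewriting with equality of arrows *)

#[local] Instance arr_eq_Equivalence (A B : obj) : Equivalence (@arr_eq P A B).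
Proof. exact: arr_eq_equiv. Qed.

#[local] Instance Comp_Proper (A B C : obj) :
  Proper (@arr_eq P B C ==> @arr_eq P A B ==> @arr_eq P A C) (@Comp P A B C).
Proof. by move=> g g' eg f f' ef; exact: arr_comp. Qed.

#[local] Instance Tens_Proper (A A' B B' : obj) :
  Proper (@arr_eq P A A' ==> @arr_eq P B B' ==>
          @arr_eq P (A ⊗ B) (A' ⊗ B')) (@Tens P A A' B B').
Proof. by move=> f f' ef g g' eg; exact: arr_tens. Qed.

#[local] Instance Tarr_Proper (A B : obj) :
  Proper (@arr_eq P A B ==> @arr_eq P (T A) (T B)) (@Tarr P A B).
Proof. by move=> f f' ef; exact: arr_T. Qed.

#[local] Hint Extern 0 (_ ≡ _) => exact: arr_refl : core.

(** Composites are kept nested to the right, so an equation whose left side is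
    [f ∘ g] must also be available below a further composite [f ∘ g ∘ k]. *)
Lemma comp_under (A B C D : obj) (f : arr C D) (g : arr B C) (h : arr B D) :
  f ∘ g ≡ h -> forall k : arr A B, f ∘ g ∘ k ≡ h ∘ k.
Proof. by move=> e k; rewrite cat_assoc e. Qed.

Lemma comp_under3 (A B C D E : obj) (f : arr D E) (g : arr C D) (g' : arr B C)
    (h : arr B E) :
  f ∘ g ∘ g' ≡ h -> forall k : arr A B, f ∘ g ∘ g' ∘ k ≡ h ∘ k.
Proof. by move=> e k; rewrite -e -!cat_assoc. Qed.

Tactic Notation "rw" uconstr(E) :=
  first [rewrite E | rewrite (comp_under E) | rewrite (comp_under3 E)];
  rewrite -?cat_assoc.

Lemma tens_merge (A B C A' B' C' : obj) (g : arr B C) (f : arr A B)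
    (g' : arr B' C') (f' : arr A' B') :
  (g ⊗₁ g') ∘ (f ⊗₁ f') ≡ (g ∘ f) ⊗₁ (g' ∘ f').
Proof. by rewrite tens_comp. Qed.

Lemma tensl (A B C D : obj) (g : arr B C) (f : arr A B) :
  (g ∘ f) ⊗₁ Id D ≡ (g ⊗₁ Id D) ∘ (f ⊗₁ Id D).
Proof. by rewrite tens_merge cat_idl. Qed.

Lemma tensr (A B C D : obj) (g : arr B C) (f : arr A B) :
  Id D ⊗₁ (g ∘ f) ≡ (Id D ⊗₁ g) ∘ (Id D ⊗₁ f).
Proof. by rewrite tens_merge cat_idl. Qed.

Lemma tens_comp_idl (A B C A' B' : obj) (g : arr B C) (f : arr A B)
    (k : arr A' B') : (g ∘ f) ⊗₁ k ≡ (g ⊗₁ Id B') ∘ (f ⊗₁ k).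
Proof. by rewrite tens_merge cat_idl. Qed.

Lemma tens_comp_idr (A B C A' B' : obj) (g : arr B C) (f : arr A B)
    (k : arr A' B') : k ⊗₁ (g ∘ f) ≡ (Id B' ⊗₁ g) ∘ (k ⊗₁ f).
Proof. by rewrite tens_merge cat_idl. Qed.

Lemma tens_lr (A A' B B' : obj) (f : arr A A') (g : arr B B') :
  f ⊗₁ g ≡ (f ⊗₁ Id B') ∘ (Id A ⊗₁ g).
Proof. by rewrite tens_merge cat_idl cat_idr. Qed.

Lemma tens_rl (A A' B B' : obj) (f : arr A A') (g : arr B B') :
  f ⊗₁ g ≡ (Id A' ⊗₁ g) ∘ (f ⊗₁ Id B).
Proof. by rewrite tens_merge cat_idl cat_idr. Qed.

Lemma cancel_epi (A B C : obj) (e : arr A B) (e' : arr B A) (f g : arr B C) :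
  e ∘ e' ≡ Id B -> f ∘ e ≡ g ∘ e -> f ≡ g.
Proof.
by move=> ee fg; rewrite -[f]cat_idr -[g]cat_idr -ee !cat_assoc fg.
Qed.

Lemma cancel_mono (A B C : obj) (e : arr B C) (e' : arr C B) (f g : arr A B) :
  e' ∘ e ≡ Id B -> e ∘ f ≡ e ∘ g -> f ≡ g.
Proof.
by move=> ee fg; rewrite -[f]cat_idl -[g]cat_idl -ee -!cat_assoc fg.
Qed.

(** * Coherence of the units *)

(** Tensoring with the unit object is naturally isomorphic to the identity. *)
Lemma unit_tens_inj (A B : obj) (f g : arr A B) :
  Id I ⊗₁ f ≡ Id I ⊗₁ g -> f ≡ g.
Proof.
move=> e; apply: (cancel_epi (lunitVK A)).
by rewrite -!lunit_nat e.
Qed.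

Lemma tens_unit_inj (A B : obj) (f g : arr A B) :
  f ⊗₁ Id I ≡ g ⊗₁ Id I -> f ≡ g.
Proof.
move=> e; apply: (cancel_epi (runitVK A)).
by rewrite -!runit_nat e.
Qed.

(** Kelly's argument: after tensoring with the unit on the left, the equation
    is one face of a pentagon whose other faces are triangles and naturality
    squares. *)
Lemma lunit_tens (A B : obj) :
  Lunit (A ⊗ B) ∘ Assoc I A B ≡ Lunit A ⊗₁ Id B.
Proof.
apply: unit_tens_inj; rewrite tensr.
apply: (@cancel_epi _ _ _ (Assoc I (I ⊗ A) B ∘ (Assoc I I A ⊗₁ Id B))
  ((AssocV I I A ⊗₁ Id B) ∘ AssocV I (I ⊗ A) B)).
  rewrite -cat_assoc; rw (tens_merge (Assoc _ _ _) _ _ _).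
  by rewrite assocVK cat_idl tens_id cat_idl assocVK.
rewrite -cat_assoc; rw (symmetry (pentagon _ _ _ _)).
rw (triangle _ _); rewrite -tens_id; rw (symmetry (assoc_nat _ _ _)).
rw (symmetry (assoc_nat _ _ _)).
by rewrite tens_merge triangle cat_idl.
Qed.

Lemma runit_tens (A B : obj) :
  (Id A ⊗₁ Runit B) ∘ Assoc A B I ≡ Runit (A ⊗ B).
Proof.
apply: tens_unit_inj; rewrite tensl.
apply: (cancel_mono (assocK _ _ _)).
rw (assoc_nat _ _ _); rewrite -(triangle B) tensr -cat_assoc.
rw (symmetry (pentagon _ _ _ _)).
rw (symmetry (assoc_nat _ _ _)).
by rewrite tens_id triangle.
Qed.

Lemma lunit_tens_unit (B : obj) : Lunit (I ⊗ B) ≡ Id I ⊗₁ Lunit B.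
Proof.
apply: (cancel_mono (lunitK _)).
by rewrite lunit_nat.
Qed.

Lemma runit_unit : Runit I ≡ Lunit I.
Proof.
by apply: tens_unit_inj; rewrite -triangle -lunit_tens lunit_tens_unit.
Qed.

(** * The lax monoidal structure of T *)

(** The two orders of merging agree by [psiL_psiR]. The body is locked so that
    rewriting with associativity of composition does not see through it. *)
Definition psi (A B : obj) : arr (T A ⊗ T B) (T (A ⊗ B)) :=
  locked (Mu (A ⊗ B) ∘ Tarr (PsiR A B) ∘ PsiL A (T B)).

Lemma psi_def (A B : obj) :
  psi A B ≡ Mu (A ⊗ B) ∘ Tarr (PsiR A B) ∘ PsiL A (T B).
Proof. by rewrite /psi -lock. Qed.

Lemma psi_defL (A B : obj) :
  psi A B ≡ Mu (A ⊗ B) ∘ Tarr (PsiL A B) ∘ PsiR (T A) B.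
Proof. by rewrite psiL_psiR psi_def. Qed.

Lemma psi_nat (A A' B B' : obj) (f : arr A A') (g : arr B B') :
  psi A' B' ∘ (Tarr f ⊗₁ Tarr g) ≡ Tarr (f ⊗₁ g) ∘ psi A B.
Proof.
rewrite !psi_def -!cat_assoc psiL_nat.
rw (symmetry (T_comp _ _)); rewrite psiR_nat T_comp -cat_assoc.
by rw (mu_nat _).
Qed.

Lemma psi_etaL (A B : obj) : psi A B ∘ (Eta A ⊗₁ Id (T B)) ≡ PsiR A B.
Proof.
rewrite !psi_def -!cat_assoc psiL_eta -eta_nat.
by rw (mu_etaT _); rewrite cat_idl.
Qed.

Lemma psi_etaR (A B : obj) : psi A B ∘ (Id (T A) ⊗₁ Eta B) ≡ PsiL A B.
Proof.
rewrite psi_defL -!cat_assoc psiR_eta -eta_nat.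
by rw (mu_etaT _); rewrite cat_idl.
Qed.

Lemma psi_eta (A B : obj) : psi A B ∘ (Eta A ⊗₁ Eta B) ≡ Eta (A ⊗ B).
Proof.
rewrite -[X in X ⊗₁ _]cat_idr -[X in _ ⊗₁ X]cat_idl tens_comp.
by rw (psi_etaL _ _); rewrite psiR_eta.
Qed.

Lemma psi_muL (A B : obj) :
  psi A B ∘ (Mu A ⊗₁ Id (T B))
  ≡ Mu (A ⊗ B) ∘ Tarr (psi A B) ∘ PsiL (T A) (T B).
Proof.
rewrite !psi_def !T_comp -!cat_assoc psiL_mu.
rw (symmetry (mu_nat _)).
by rw (mu_assoc _).
Qed.

Lemma psi_muR (A B : obj) :
  psi A B ∘ (Id (T A) ⊗₁ Mu B)
  ≡ Mu (A ⊗ B) ∘ Tarr (psi A B) ∘ PsiR (T A) (T B).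
Proof.
rewrite !psi_defL !T_comp -!cat_assoc psiR_mu.
rw (symmetry (mu_nat _)).
by rw (mu_assoc _).
Qed.

(** The special case of associativity of [psi] in which the middle factor has
    no T; it rests on [psiL_assoc] and [psiR_assoc]. *)
Lemma psi_psiL_psiR (A B C : obj) :
  Tarr (Assoc A B C) ∘ psi (A ⊗ B) C ∘ (PsiL A B ⊗₁ Id (T C))
  ≡ psi A (B ⊗ C) ∘ (Id (T A) ⊗₁ PsiR B C) ∘ Assoc (T A) B (T C).
Proof.
rewrite !psi_def -!cat_assoc.
rw (symmetry (mu_nat _)).
rw (symmetry (T_comp _ _)); rewrite psiR_assoc !T_comp -!cat_assoc.
rewrite psiL_assoc.
by rewrite -T_id; rw (psiL_nat _ _).
Qed.

(** The mixed law [psiLR_assoc] lets the middle T come outermost on both sides;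
    what remains below T is [psi_psiL_psiR]. *)
Lemma psi_assoc (A B C : obj) :
  Tarr (Assoc A B C) ∘ psi (A ⊗ B) C ∘ (psi A B ⊗₁ Id (T C))
  ≡ psi A (B ⊗ C) ∘ (Id (T A) ⊗₁ psi B C) ∘ Assoc (T A) (T B) (T C).
Proof.
(* Of the two forms of [psi], the ones that treat the middle T first. *)
rewrite (psi_defL A B) (psi_def B C) !(tensl,tensr) -!cat_assoc.
rw (psi_muL _ _); rw (psi_muR _ _).
rw (symmetry (mu_nat _)); rw (psiL_nat _ _).
rw (psiR_nat _ _).
rw (symmetry (psiLR_assoc _ _ _)).
rw (symmetry (T_comp _ _)).
rw (symmetry (T_comp _ _)).
rewrite psi_psiL_psiR.
by rewrite !T_comp -!cat_assoc.
Qed.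


(** * Arrows into the unit and into a generator *)

Fixpoint unital (A : obj) : Prop :=
  match A with
  | Unit => True
  | Tensor A B => unital A /\ unital B
  | _ => False
  end.

Fixpoint to_unit (A : obj) : unital A -> arr A I :=
  match A return unital A -> arr A I with
  | Gen _ => fun x => match x with end
  | Unit => fun _ => Id I
  | Tensor A B => fun x =>
      let: conj a b := x in Lunit I ∘ (to_unit a ⊗₁ to_unit b)
  | Tob _ => fun x => match x with end
  end.

Lemma unital_irr (A : obj) (x y : unital A) : x = y.
Proof.
elim: A x y => [p||A IHA B IHB|A IHA] //=; first by case; case.
by case=> a b [a' b']; rewrite (IHA a a') (IHB b b').
Qed.

Lemma lunit2_assoc :
  Lunit I ∘ (Id I ⊗₁ Lunit I) ∘ Assoc I I I ≡ Lunit I ∘ (Lunit I ⊗₁ Id I).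
Proof. by rewrite triangle runit_unit. Qed.

Lemma to_unit_assoc (A B C : obj) (y : unital (A ⊗ (B ⊗ C)))
    (x : unital (A ⊗ B ⊗ C)) : to_unit y ∘ Assoc A B C ≡ to_unit x.
Proof.
case: y => a [b c]; rewrite (unital_irr x (conj (conj a b) c)) /=.
rewrite tens_comp_idl tens_comp_idr -!cat_assoc.
rw (symmetry (assoc_nat _ _ _)).
by rw lunit2_assoc.
Qed.

Lemma assoc_to_assocV (A B C X : obj) (f : arr (A ⊗ (B ⊗ C)) X)
    (g : arr (A ⊗ B ⊗ C) X) :
  f ∘ Assoc A B C ≡ g -> g ∘ AssocV A B C ≡ f.
Proof. by move=> <-; rewrite -cat_assoc assocVK cat_idr. Qed.

(** No T can occur in the source or along the way, since T is never removed
    completely; the cases with target [T A] are vacuous. *)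
Lemma to_unit_nat (A B : obj) (f : arr A B) (y : unital B) :
  exists x : unital A, to_unit y ∘ f ≡ to_unit x.
Proof.
elim: {A B} f y => /=; try by [].
- by move=> A y; exists y; rewrite cat_idr.
- move=> A B C g IHg f IHf y; have [x ex] := IHg y; have [w ew] := IHf x.
  by exists w; rewrite cat_assoc ex.
- move=> A A' B B' f IHf g IHg [a b]; have [x ex] := IHf a.
  by have [y ey] := IHg b; exists (conj x y); rewrite -cat_assoc tens_merge ex ey.
- move=> A B C [a [b c]]; exists (conj (conj a b) c).
  exact: (to_unit_assoc (conj a (conj b c)) (conj (conj a b) c)).
- move=> A B C [[a b] c]; exists (conj a (conj b c)).
  apply: assoc_to_assocV.
  exact: (to_unit_assoc (conj a (conj b c)) (conj (conj a b) c)).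
- by move=> A a; exists (conj Logic.I a); rewrite lunit_nat.
- move=> A [[] a]; exists a.
  by rewrite lunit_nat -cat_assoc lunitVK cat_idr.
- by move=> A a; exists (conj a Logic.I); rewrite -runit_unit runit_nat.
- move=> A [a []]; exists a.
  by rewrite -runit_unit runit_nat -cat_assoc runitVK cat_idr.
Qed.

(** Evidence that the leaves of [A] are one generator, equal to [p], and
    units, and that T does not occur in [A]. *)
Fixpoint sole (p : P) (A : obj) : Type :=
  match A with
  | Gen q => q = p
  | Tensor A B => sole p A * unital B + unital A * sole p B
  | _ => False
  end.

Fixpoint to_gen (p : P) (A : obj) : sole p A -> arr A (Gen p) :=
  match A return sole p A -> arr A (Gen p) with
  | Gen q => fun e => match e in _ = r return arr (Gen q) (Gen r) with
                      | erefl => Id (Gen q)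
                      end
  | Unit => fun x => match x with end
  | Tensor A B => fun x => match x with
      | inl (a, b) => Runit (Gen p) ∘ (to_gen a ⊗₁ to_unit b)
      | inr (a, b) => Lunit (Gen p) ∘ (to_unit a ⊗₁ to_gen b)
      end
  | Tob _ => fun x => match x with end
  end.

Lemma sole_unital (p : P) (A : obj) : sole p A -> unital A -> False.
Proof.
elim: A => [q||A IHA B IHB|A IHA] //=.
by case=> [[a b] [a' b'] | [a b] [a' b']]; auto.
Qed.

(** The position of the generator is determined by [A]; identity of the label
    is unique because proofs of equality in [P] are. *)
Lemma sole_irr (p : P) (A : obj) (x y : sole p A) : x = y.
Proof.
elim: A x y => [q||A IHA B IHB|A IHA] //=.
  by move=> x y; exact: UIP.
case=> [[a b]|[a b]] [[a' b']|[a' b']].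
- by rewrite (IHA a a') (unital_irr b b').
- by case: (sole_unital a a').
- by case: (sole_unital a' a).
- by rewrite (IHB b b') (unital_irr a a').
Qed.

Lemma to_gen_assoc (p : P) (A B C : obj) (y : sole p (A ⊗ (B ⊗ C)))
    (x : sole p (A ⊗ B ⊗ C)) : to_gen y ∘ Assoc A B C ≡ to_gen x.
Proof.
case: y => [[a [b c]]|[a [[b c]|[b c]]]].
- rewrite (sole_irr x (inl (inl (a, b), c))) /=.
  rewrite tens_comp_idl tens_comp_idr -!cat_assoc.
  rw (symmetry (assoc_nat _ _ _)).
  by rw (triangle _ _).
- rewrite (sole_irr x (inl (inr (a, b), c))) /=.
  rewrite tens_comp_idl tens_comp_idr -!cat_assoc.
  rw (symmetry (assoc_nat _ _ _)); rw (runit_tens _ _).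
  by rw (runit_nat (Lunit _)).
- rewrite (sole_irr x (inr (conj a b, c))) /=.
  rewrite tens_comp_idl tens_comp_idr -!cat_assoc.
  rw (symmetry (assoc_nat _ _ _)); rw (triangle _ _).
  by rewrite runit_unit.
Qed.

Lemma to_gen_nat (p : P) (A B : obj) (f : arr A B) (y : sole p B) :
  exists x : sole p A, to_gen y ∘ f ≡ to_gen x.
Proof.
elim: {A B} f y => /=; try by [].
- by move=> A y; exists y; rewrite cat_idr.
- move=> A B C g IHg f IHf y; have [x ex] := IHg y; have [w ew] := IHf x.
  by exists w; rewrite cat_assoc ex.
- move=> A A' B B' f IHf g IHg [[a b]|[a b]].
    have [x ex] := IHf a; have [y ey] := to_unit_nat g b.
    by exists (inl (x, y)); rewrite -cat_assoc tens_merge ex ey.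
  have [x ex] := to_unit_nat f a; have [y ey] := IHg b.
  by exists (inr (x, y)); rewrite -cat_assoc tens_merge ex ey.
- move=> A B C y.
  suff x : sole p (A ⊗ B ⊗ C) by exists x; exact: to_gen_assoc.
  by move: y => [[a [b c]]|[a [[b c]|[b c]]]] /=; tauto.
- move=> A B C y.
  suff x : sole p (A ⊗ (B ⊗ C)).
    by exists x; apply: assoc_to_assocV; exact: (to_gen_assoc x y).
  by move: y => [[[[a b]|[a b]] c]|[[a b] c]] /=; tauto.
- by move=> A a; exists (inr (Logic.I, a)); rewrite lunit_nat.
- move=> A [[[] b]|[[] a]] //; exists a.
  by rewrite lunit_nat -cat_assoc lunitVK cat_idr.
- by move=> A a; exists (inl (a, Logic.I)); rewrite runit_nat.
- move=> A [[a []]|[a []]]; exists a.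
  by rewrite runit_nat -cat_assoc runitVK cat_idr.
Qed.

(** By naturality, every arrow into the unit object is the canonical one. *)
Lemma arr_unit_eq (A : obj) (f g : arr A I) : f ≡ g.
Proof.
have [x] := @to_unit_nat _ I f Logic.I; have [y] := @to_unit_nat _ I g Logic.I.
by rewrite (unital_irr x y) /= !cat_idl => -> ->.
Qed.

Lemma arr_gen_eq (p : P) (A : obj) (f g : arr A (Gen p)) : f ≡ g.
Proof.
have [x] := @to_gen_nat p _ (Gen p) f erefl.
have [y] := @to_gen_nat p _ (Gen p) g erefl.
by rewrite (sole_irr x y) /= !cat_idl => -> ->.
Qed.


(** * Collecting marked occurrences of T *)

(** A marking is a set of occurrences of T closed upwards: [None] at an
    occurrence of T says that neither it nor anything below it is marked. *)
Fixpoint marks (A : obj) : Type :=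
  match A with
  | Gen _ | Unit => unit
  | Tensor A B => (marks A * marks B)%type
  | Tob A => option (marks A)
  end.

Fixpoint erase (A : obj) : marks A -> obj :=
  match A return marks A -> obj with
  | Gen p => fun _ => Gen p
  | Unit => fun _ => I
  | Tensor A B => fun m => erase m.1 ⊗ erase m.2
  | Tob A => fun m => if m is Some m' then erase m' else T A
  end.

(** The canonical arrow that merges all marked occurrences of T into a single
    outermost one, which is created by [Eta] when nothing is marked. *)
Fixpoint collect (A : obj) : forall m : marks A, arr A (T (erase m)) :=
  match A return forall m : marks A, arr A (T (erase m)) with
  | Gen p => fun _ => Eta (Gen p)
  | Unit => fun _ => Eta I
  | Tensor A B => fun m =>
      psi (erase m.1) (erase m.2) ∘ (collect m.1 ⊗₁ collect m.2)
  | Tob A => fun m => match m return arr (T A) (T (@erase (T A) m)) with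
      | Some m' => Mu (erase m') ∘ Tarr (collect m')
      | None => Eta (T A)
      end
  end.

Fixpoint no_marks (A : obj) : marks A :=
  match A with
  | Gen _ | Unit => tt
  | Tensor A B => (no_marks A, no_marks B)
  | Tob A => None
  end.

(** Erasing nothing gives back [A], but not by computation for a variable [A];
    the comparison arrow [u] replaces a transport. *)
Lemma collect_no_marks (A : obj) :
  exists u : arr (erase (no_marks A)) A,
    Tarr u ∘ collect (no_marks A) ≡ Eta A.
Proof.
elim: A => [p||A [u eu] B [v ev]|A _] /=.
- by exists (Id _); rewrite T_id cat_idl.
- by exists (Id _); rewrite T_id cat_idl.
- exists (u ⊗₁ v); rw (symmetry (psi_nat _ _)).
  by rewrite tens_merge eu ev psi_eta.
- by exists (Id _); rewrite T_id cat_idl.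
Qed.

(** Naturality of [collect]: the marking [m'] is the preimage of [m] under the
    occurrences of T, which is again closed upwards, and [f'] is what remains
    of [f] once the marked occurrences are erased. *)
Lemma collect_nat (A B : obj) (f : arr A B) (m : marks B) :
  exists (m' : marks A) (f' : arr (erase m') (erase m)),
    collect m ∘ f ≡ Tarr f' ∘ collect m'.
Proof.
elim: {A B} f m.
- by move=> A m; exists m, (Id _); rewrite T_id cat_idl cat_idr.
- move=> A B C g IHg f IHf m; have [m1 [g' eg]] := IHg m.
  have [m2 [f' ef]] := IHf m1; exists m2, (g' ∘ f').
  by rewrite cat_assoc eg -cat_assoc ef T_comp cat_assoc.
- move=> A A' B B' f IHf g IHg [m1 m2]; have [n1 [f' ef]] := IHf m1.
  have [n2 [g' eg]] := IHg m2; exists (n1, n2), (f' ⊗₁ g') => /=.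
  rewrite -cat_assoc tens_merge ef eg -tens_merge; by rw (psi_nat _ _).
- move=> A B f IHf [m|] /=; last first.
    by exists None, (Tarr f); rewrite /= eta_nat.
  have [n [f' ef]] := IHf m; exists (Some n), f'.
  rewrite /= -cat_assoc -T_comp ef T_comp; by rw (mu_nat _).
- move=> A B C [m1 [m2 m3]]; exists ((m1, m2), m3), (Assoc _ _ _) => /=.
  rewrite tens_comp_idl tens_comp_idr -!cat_assoc.
  by rw (psi_assoc _ _ _); rewrite assoc_nat.
- move=> A B C [[m1 m2] m3]; exists (m1, (m2, m3)), (AssocV _ _ _) => /=.
  apply: assoc_to_assocV.
  rewrite tens_comp_idl tens_comp_idr -!cat_assoc.
  rw (symmetry (assoc_nat _ _ _)); rw (symmetry (psi_assoc _ _ _)).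
  by rw (symmetry (T_comp _ _)); rewrite assocK T_id cat_idl.
- move=> A m; exists (tt, m), (Lunit _) => /=.
  rewrite tens_lr -?cat_assoc; rw (psi_etaL _ _); rw (psiR_lunit _).
  by rewrite lunit_nat.
- move=> A [[] m]; exists m, (LunitV _) => /=.
  apply: (cancel_mono (e := Tarr (Lunit _)) (e' := Tarr (LunitV _))).
    by rewrite -T_comp lunitK T_id.
  rw (symmetry (T_comp _ _)); rewrite lunitVK T_id cat_idl.
  rewrite tens_lr -?cat_assoc; rw (psi_etaL _ _); rw (psiR_lunit _).
  by rw (lunit_nat _); rewrite lunitVK cat_idr.
- move=> A m; exists (m, tt), (Runit _) => /=.
  rewrite tens_rl -?cat_assoc; rw (psi_etaR _ _); rw (psiL_runit _).
  by rewrite runit_nat.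
- move=> A [m []]; exists m, (RunitV _) => /=.
  apply: (cancel_mono (e := Tarr (Runit _)) (e' := Tarr (RunitV _))).
    by rewrite -T_comp runitK T_id.
  rw (symmetry (T_comp _ _)); rewrite runitVK T_id cat_idl.
  rewrite tens_rl -?cat_assoc; rw (psi_etaR _ _); rw (psiL_runit _).
  by rw (runit_nat _); rewrite runitVK cat_idr.
- move=> A [m|] /=.
    exists m, (Id _); rewrite T_id cat_idl -cat_assoc -eta_nat.
    by rw (mu_etaT _); rewrite cat_idl.
  have [u eu] := collect_no_marks A; exists (no_marks A), (Eta A ∘ u).
  by rewrite T_comp -cat_assoc eu eta_nat.
- move=> A [m|] /=; last by exists None, (Mu A); rewrite /= eta_nat.
  exists (Some (Some m)), (Id _) => /=.
  rewrite T_id cat_idl T_comp -!cat_assoc -mu_nat.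
  by rw (mu_assoc _).
- move=> A B [[m n]|] /=.
    exists (Some m, n), (Id _); rewrite /= T_id cat_idl T_comp -!cat_assoc.
    by rewrite -psiL_nat tens_comp_idl; rw (psi_muL _ _).
  have [u eu] := collect_no_marks B.
  exists (None, no_marks B), (PsiL A B ∘ (Id _ ⊗₁ u)) => /=.
  rewrite T_comp -!cat_assoc; rw (symmetry (psi_nat _ _)).
  by rewrite tens_merge eu T_id cat_idl psi_eta eta_nat.
- move=> A B [[m n]|] /=.
    exists (m, Some n), (Id _); rewrite /= T_id cat_idl T_comp -!cat_assoc.
    by rewrite -psiR_nat tens_comp_idr; rw (psi_muR _ _).
  have [u eu] := collect_no_marks A.
  exists (no_marks A, None), (PsiR A B ∘ (u ⊗₁ Id _)) => /=.
  rewrite T_comp -!cat_assoc; rw (symmetry (psi_nat _ _)).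
  by rewrite tens_merge eu T_id cat_idl psi_eta eta_nat.
Qed.

(** Normal form of an arrow into [T B]: collect the occurrences of T that go to
    the outermost T, then act below it. This is naturality of [collect] for
    the marking of the outermost T alone, for which [collect] is, by a unit
    law of the monad, invertible. *)
Lemma factor_collect (A B : obj) (f : arr A (T B)) :
  exists (m : marks A) (g : arr (erase m) B), f ≡ Tarr g ∘ collect m.
Proof.
have [u eu] := collect_no_marks B.
have [m [g eg]] := collect_nat f (Some (no_marks B) : marks (T B)).
exists m, (u ∘ g); rewrite T_comp -cat_assoc -eg /=.
rewrite -!cat_assoc; rw (symmetry (mu_nat _)).
by rw (symmetry (T_comp _ _)); rewrite eu; rw (mu_Teta _); rewrite cat_idl.
Qed.


(** * Splittings of an object *)

Definition iso (A B : obj) (f : arr A B) : Prop :=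
  exists g : arr B A, g ∘ f ≡ Id A /\ f ∘ g ≡ Id B.

Lemma iso_id (A : obj) : iso (Id A).
Proof. by exists (Id A); rewrite cat_idl. Qed.

Lemma iso_comp (A B C : obj) (g : arr B C) (f : arr A B) :
  iso g -> iso f -> iso (g ∘ f).
Proof.
move=> [g' [g1 g2]] [f' [f1 f2]]; exists (f' ∘ g'); split; rewrite -cat_assoc.
  by rw g1; rewrite cat_idl.
by rw f2; rewrite cat_idl.
Qed.

Lemma iso_tens (A A' B B' : obj) (f : arr A A') (g : arr B B') :
  iso f -> iso g -> iso (f ⊗₁ g).
Proof.
move=> [f' [f1 f2]] [g' [g1 g2]]; exists (f' ⊗₁ g').
by rewrite !tens_merge f1 f2 g1 g2 !tens_id.
Qed.

Lemma iso_assoc (A B C : obj) : iso (Assoc A B C).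
Proof. by exists (AssocV A B C); rewrite assocK assocVK. Qed.

Lemma iso_assocV (A B C : obj) : iso (AssocV A B C).
Proof. by exists (Assoc A B C); rewrite assocK assocVK. Qed.

Lemma iso_lunit (A : obj) : iso (Lunit A).
Proof. by exists (LunitV A); rewrite lunitK lunitVK. Qed.

Lemma iso_lunitV (A : obj) : iso (LunitV A).
Proof. by exists (Lunit A); rewrite lunitK lunitVK. Qed.

Lemma iso_runit (A : obj) : iso (Runit A).
Proof. by exists (RunitV A); rewrite runitK runitVK. Qed.

Lemma iso_runitV (A : obj) : iso (RunitV A).
Proof. by exists (Runit A); rewrite runitK runitVK. Qed.

#[local] Hint Resolve iso_id iso_comp iso_tens iso_assoc iso_assocV iso_lunit
  iso_lunitV iso_runit iso_runitV : iso.

Lemma iso_to_unit (A : obj) (x : unital A) : iso (to_unit x).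
Proof.
elim: A x => [p||A IHA B IHB|A IHA] //=; first by auto with iso.
by case=> a b; auto with iso.
Qed.

(** same_split *)
(** Two ways of presenting [A] as a tensor product that differ by arrows acting
    separately on the two factors. *)
Definition split_equiv (A L R L' R' : obj) (s : arr A (L ⊗ R))
    (s' : arr A (L' ⊗ R')) : Prop :=
  exists (u : arr L L') (v : arr R R'), iso u /\ iso v /\ (u ⊗₁ v) ∘ s ≡ s'.

Lemma split_equiv_refl (A L R : obj) (s : arr A (L ⊗ R)) : split_equiv s s.
Proof.
by exists (Id L), (Id R); rewrite tens_id cat_idl; auto with iso.
Qed.

Lemma split_equiv_sym (A L R L' R' : obj) (s : arr A (L ⊗ R))
    (s' : arr A (L' ⊗ R')) : split_equiv s s' -> split_equiv s' s.
Proof.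
move=> [u [v [[u' [u1 u2]] [[v' [v1 v2]] e]]]]; exists u', v'.
split; first by exists u. split; first by exists v.
by rewrite -e cat_assoc tens_merge u1 v1 tens_id cat_idl.
Qed.

Lemma split_equiv_trans (A L R L' R' L2 R2 : obj) (s : arr A (L ⊗ R))
    (s' : arr A (L' ⊗ R')) (s2 : arr A (L2 ⊗ R2)) :
  split_equiv s s' -> split_equiv s' s2 -> split_equiv s s2.
Proof.
move=> [u [v [iu [iv e]]]] [u' [v' [iu' [iv' e']]]].
exists (u' ∘ u), (v' ∘ v); split; first by auto with iso.
split; first by auto with iso.
by rewrite -tens_merge -cat_assoc e e'.
Qed.

(** A splitting whose left factor is trivial is the trivial one: its right
    factor must be isomorphic to [A] through [s] itself. *)
Lemma split_equiv_unital_left (A L R : obj) (s : arr A (L ⊗ R)) :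
  iso s -> unital L -> split_equiv s (LunitV A).
Proof.
move=> [s' [s1 s2]] x; have [z' [z1 z2]] := iso_to_unit x.
exists (to_unit x), (s' ∘ (z' ⊗₁ Id R) ∘ LunitV R).
split; first exact: iso_to_unit.
split.
  apply: iso_comp; first by exists s.
  apply: iso_comp; last by auto with iso.
  by apply: iso_tens; [exists (to_unit x) | auto with iso].
apply: (cancel_mono (lunitK A)); rewrite lunitVK.
rewrite tens_rl -?cat_assoc; rw (lunit_nat _).
rewrite -?cat_assoc; rw (lunitK _); rewrite cat_idl.
rw (tens_merge _ _ _ _).
by rewrite z1 cat_idl tens_id cat_idl.
Qed.

Lemma split_equiv_unital_right (A L R : obj) (s : arr A (L ⊗ R)) :
  iso s -> unital R -> split_equiv s (RunitV A).
Proof.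
move=> [s' [s1 s2]] x; have [z' [z1 z2]] := iso_to_unit x.
exists (s' ∘ (Id L ⊗₁ z') ∘ RunitV L), (to_unit x).
split.
  apply: iso_comp; first by exists s.
  apply: iso_comp; last by auto with iso.
  by apply: iso_tens; [auto with iso | exists (to_unit x)].
split; first exact: iso_to_unit.
apply: (cancel_mono (runitK A)); rewrite runitVK.
rewrite tens_lr -?cat_assoc; rw (runit_nat _).
rewrite -?cat_assoc; rw (runitK _); rewrite cat_idl.
rw (tens_merge _ _ _ _).
by rewrite z1 cat_idl tens_id cat_idl.
Qed.

(** A cut separates the generators and the outermost occurrences of T of [A]
    into left and right ones. At a generator or an occurrence of T, [true] puts it
    on the left. A cut between the two factors of a tensor product is
    represented twice, at the right end of the first factor and at the left
    end of the second; [split_equiv_weight] compares the representations. *)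
Fixpoint cut (A : obj) : Type :=
  match A with
  | Gen _ | Tob _ => bool
  | Unit => unit
  | Tensor A B => (cut A + cut B)%type
  end.

Fixpoint cutL (A : obj) : cut A -> obj :=
  match A return cut A -> obj with
  | Tensor A B => fun c =>
      match c with inl c => cutL c | inr c => A ⊗ cutL c end
  | Unit => fun _ => I
  | A => fun b : bool => if b then A else I
  end.

Fixpoint cutR (A : obj) : cut A -> obj :=
  match A return cut A -> obj with
  | Tensor A B => fun c =>
      match c with inl c => cutR c ⊗ B | inr c => cutR c end
  | Unit => fun _ => I
  | A => fun b : bool => if b then I else A
  end.

Definition side (A : obj) (b : bool) :
    arr A ((if b then A else I) ⊗ (if b then I else A)) :=
  if b return arr A ((if b then A else I) ⊗ (if b then I else A))
  then RunitV A else LunitV A.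

Fixpoint cut_arr (A : obj) : forall c : cut A, arr A (cutL c ⊗ cutR c) :=
  match A return forall c : cut A, arr A (cutL c ⊗ cutR c) with
  | Tensor A B => fun c =>
      match c return arr (A ⊗ B) (@cutL (A ⊗ B) c ⊗ @cutR (A ⊗ B) c) with
      | inl c => Assoc (cutL c) (cutR c) B ∘ (cut_arr c ⊗₁ Id B)
      | inr c => AssocV A (cutL c) (cutR c) ∘ (Id A ⊗₁ cut_arr c)
      end
  | Unit => fun _ => LunitV I
  | Gen p => side (Gen p)
  | Tob A => side (T A)
  end.

Lemma iso_cut_arr (A : obj) (c : cut A) : iso (cut_arr c).
Proof.
elim: A c => [p||A IHA B IHB|A IHA] /=; try by case; auto with iso.
Qed.

Lemma cut_left (A : obj) : exists c : cut A, unital (cutL c).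
Proof.
elim: A => [p||A [c ec] B _|A _]; [by exists false | by exists tt | |
  by exists false].
by exists (inl c).
Qed.

Lemma cut_right (A : obj) : exists c : cut A, unital (cutR c).
Proof.
elim: A => [p||A _ B [c ec]|A _]; [by exists true | by exists tt | |
  by exists true].
by exists (inr c).
Qed.

Lemma lunitV_nat (A B : obj) (f : arr A B) :
  LunitV B ∘ f ≡ (Id I ⊗₁ f) ∘ LunitV A.
Proof.
apply: (cancel_mono (lunitK B)); rw (lunit_nat _).
rw (lunitVK _); rewrite cat_idr; rw (lunitVK _).
by rewrite cat_idl.
Qed.

Lemma runitV_nat (A B : obj) (f : arr A B) :
  RunitV B ∘ f ≡ (f ⊗₁ Id I) ∘ RunitV A.
Proof.
apply: (cancel_mono (runitK B)); rw (runit_nat _).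
rw (runitVK _); rewrite cat_idr; rw (runitVK _).
by rewrite cat_idl.
Qed.

Lemma assocV_nat (A A' B B' C C' : obj) (f : arr A A') (g : arr B B')
    (h : arr C C') :
  AssocV A' B' C' ∘ (f ⊗₁ (g ⊗₁ h)) ≡ ((f ⊗₁ g) ⊗₁ h) ∘ AssocV A B C.
Proof.
apply: (cancel_mono (assocK _ _ _)); rw (assoc_nat _ _ _).
rw (assocVK _ _ _); rewrite cat_idr; rw (assocVK _ _ _).
by rewrite cat_idl.
Qed.

(** The cut [c] of the target of [f] is induced by some cut of the source, so
    that [f] decomposes along [c]. *)
Definition cut_pulls_back (A B : obj) (f : arr A B) (c : cut B) : Prop :=
  exists (d : cut A) (g : arr (cutL d) (cutL c)) (h : arr (cutR d) (cutR c)),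
    cut_arr c ∘ f ≡ (g ⊗₁ h) ∘ cut_arr d.

(** Up to isomorphism, [f] is then [Id I ⊗₁ f] by naturality of [LunitV]. *)
Lemma cut_pulls_back_unital_left (A B : obj) (f : arr A B) (c : cut B) :
  unital (cutL c) -> cut_pulls_back f c.
Proof.
move=> x; have [d y] := cut_left A.
have [u [v [_ [_ e]]]] := split_equiv_unital_left (iso_cut_arr d) y.
have [u' [v' [_ [_ e']]]] :=
  split_equiv_sym (split_equiv_unital_left (iso_cut_arr c) x).
exists d, (u' ∘ u), (v' ∘ f ∘ v).
rewrite -e' -cat_assoc lunitV_nat -e; rw (tens_merge u' _ _ _).
rw (tens_merge _ _ _ _).
by rewrite cat_idl.
Qed.

Lemma cut_pulls_back_unital_right (A B : obj) (f : arr A B) (c : cut B) :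
  unital (cutR c) -> cut_pulls_back f c.
Proof.
move=> x; have [d y] := cut_right A.
have [u [v [_ [_ e]]]] := split_equiv_unital_right (iso_cut_arr d) y.
have [u' [v' [_ [_ e']]]] :=
  split_equiv_sym (split_equiv_unital_right (iso_cut_arr c) x).
exists d, (u' ∘ f ∘ u), (v' ∘ v).
rewrite -e' -cat_assoc runitV_nat -e; rw (tens_merge u' _ _ _).
rw (tens_merge _ _ _ _).
by rewrite cat_idl.
Qed.

Lemma cut_pulls_back_equiv (A B : obj) (f : arr A B) (d : cut A) (c : cut B) :
  split_equiv (cut_arr d) (cut_arr c ∘ f) -> cut_pulls_back f c.
Proof. by move=> [u [v [_ [_ e]]]]; exists d, u, v; rewrite e. Qed.

Lemma cut_pulls_back_equivV (A B : obj) (f : arr A B) (g : arr B A) (d : cut A)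
    (c : cut B) :
  split_equiv (cut_arr d) (cut_arr c ∘ f) -> f ∘ g ≡ Id B -> cut_pulls_back g d.
Proof.
move=> /split_equiv_sym [u [v [_ [_ e]]]] fg; exists c, u, v.
by rewrite -e -!cat_assoc fg cat_idr.
Qed.

(** Rebracketing and deleting units do not affect cuts; for associativity each
    of the three positions of the cut is an instance of the pentagon. *)
Lemma split_equiv_assoc_left (A B C : obj) (c : cut A) :
  split_equiv (@cut_arr (A ⊗ B ⊗ C) (inl (inl c)))
    (@cut_arr (A ⊗ (B ⊗ C)) (inl c) ∘ Assoc A B C).
Proof.
exists (Id _), (Assoc _ _ _); split; first exact: iso_id.
split; first exact: iso_assoc.
rewrite /= tensl -!cat_assoc -tens_id; rw (symmetry (assoc_nat _ _ _)).
by rw (symmetry (pentagon _ _ _ _)).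
Qed.

Lemma split_equiv_assoc_mid (A B C : obj) (c : cut B) :
  split_equiv (@cut_arr (A ⊗ B ⊗ C) (inl (inr c)))
    (@cut_arr (A ⊗ (B ⊗ C)) (inr (inl c)) ∘ Assoc A B C).
Proof.
exists (Id _), (Id _); split; first exact: iso_id.
split; first exact: iso_id.
apply: (cancel_mono (assocK _ _ _)).
rewrite /= tensl tensr -!cat_assoc; rw (symmetry (assoc_nat _ _ _)).
rewrite tens_id cat_idl; rw (pentagon _ _ _ _).
rw (assocVK _ _ _); rewrite cat_idl.
rw (tens_merge (Assoc _ _ _) (AssocV _ _ _) _ _).
by rewrite assocVK cat_idl tens_id cat_idl.
Qed.

Lemma split_equiv_assoc_right (A B C : obj) (c : cut C) :
  split_equiv (@cut_arr (A ⊗ B ⊗ C) (inr c))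
    (@cut_arr (A ⊗ (B ⊗ C)) (inr (inr c)) ∘ Assoc A B C).
Proof.
exists (Assoc _ _ _), (Id _); split; first exact: iso_assoc.
split; first exact: iso_id.
apply: (cancel_mono (assocK _ _ _)).
apply: (cancel_mono (e := Id A ⊗₁ Assoc _ _ _) (e' := Id A ⊗₁ AssocV _ _ _)).
  by rewrite tens_merge assocK cat_idl tens_id.
rewrite /= tensr -!cat_assoc; rw (assocVK _ _ _).
rewrite cat_idl; rw (tens_merge _ _ _ (AssocV _ _ _)).
rewrite assocVK cat_idl tens_id cat_idl -assoc_nat tens_id.
rw (symmetry (pentagon _ _ _ _)).
by rw (assocVK _ _ _); rewrite cat_idl.
Qed.

Lemma split_equiv_lunit (A : obj) (c : cut A) :
  split_equiv (@cut_arr (I ⊗ A) (inr c)) (cut_arr c ∘ Lunit A).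
Proof.
exists (Lunit _), (Id _); split; first exact: iso_lunit.
split; first exact: iso_id.
rewrite /= -lunit_tens -!cat_assoc; rw (assocVK _ _ _).
by rewrite cat_idl lunit_nat.
Qed.

Lemma split_equiv_runit (A : obj) (c : cut A) :
  split_equiv (@cut_arr (A ⊗ I) (inl c)) (cut_arr c ∘ Runit A).
Proof.
exists (Id _), (Runit _); split; first exact: iso_id.
split; first exact: iso_runit.
by rewrite /=; rw (runit_tens _ _); rewrite runit_nat.
Qed.

(** An object [T Y] has trivial cuts only, so all the generating arrows with
    such a target are covered by the trivial cases. *)
Lemma cut_nat (A B : obj) (f : arr A B) (c : cut B) : cut_pulls_back f c.
Proof.
have toT X Y (h : arr X (T Y)) (d : cut (T Y)) : cut_pulls_back h d.
  case: d; first exact: cut_pulls_back_unital_right.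
  exact: cut_pulls_back_unital_left.
elim: {A B} f c; try by move=> *; exact: toT.
- by move=> A c; exists c, (Id _), (Id _); rewrite tens_id cat_idl cat_idr.
- move=> A B C g IHg f IHf c; have [d [g1 [g2 eg]]] := IHg c.
  have [e [f1 [f2 ef]]] := IHf d; exists e, (g1 ∘ f1), (g2 ∘ f2).
  by rewrite cat_assoc eg -cat_assoc ef cat_assoc tens_merge.
- move=> A A' B B' f IHf g IHg [c|c].
    have [d [f1 [f2 ef]]] := IHf c; exists (inl d), f1, (f2 ⊗₁ g).
    rewrite /= -!cat_assoc; rw (symmetry (assoc_nat _ _ _)).
    by rewrite !tens_merge -ef cat_idl cat_idr.
  have [d [g1 [g2 eg]]] := IHg c; exists (inr d), (f ⊗₁ g1), g2.
  rewrite /= -!cat_assoc; rw (symmetry (assocV_nat _ _ _)).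
  by rewrite !tens_merge -eg cat_idl cat_idr.
- move=> A B C [c|[c|c]]; apply: cut_pulls_back_equiv.
  + exact: split_equiv_assoc_left.
  + exact: split_equiv_assoc_mid.
  + exact: split_equiv_assoc_right.
- move=> A B C [[c|c]|c]; apply: cut_pulls_back_equivV (assocVK _ _ _).
  + exact: split_equiv_assoc_left.
  + exact: split_equiv_assoc_mid.
  + exact: split_equiv_assoc_right.
- by move=> A c; apply: cut_pulls_back_equiv; exact: split_equiv_lunit.
- move=> A [c|c]; first by apply: cut_pulls_back_unital_left.
  by apply: cut_pulls_back_equivV (lunitVK _); exact: split_equiv_lunit.
- by move=> A c; apply: cut_pulls_back_equiv; exact: split_equiv_runit.
- move=> A [c|c]; last by apply: cut_pulls_back_unital_right.
  by apply: cut_pulls_back_equivV (runitVK _); exact: split_equiv_runit.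
Qed.

Fixpoint gens (A : obj) : nat :=
  match A with
  | Gen _ => 1
  | Unit => 0
  | Tensor A B => gens A + gens B
  | Tob A => gens A
  end.

Lemma gens_arr (A B : obj) (f : arr A B) : gens A = gens B.
Proof. by elim: {A B} f => //= *; lia. Qed.

(** Every generator and every T counts, so that the weight of the left factor
    determines a cut up to equivalence. *)
Definition weight (A : obj) : nat := gens A + Gob A.

Lemma weight0_unital (A : obj) : weight A = 0 -> unital A.
Proof.
rewrite /weight; elim: A => [p||A IHA B IHB|A IHA] //=; last by lia.
by move=> e; split; [apply: IHA | apply: IHB]; lia.
Qed.

Lemma weight_cut (A : obj) (c : cut A) :
  weight (cutL c) + weight (cutR c) = weight A.
Proof.
rewrite /weight; elim: A c => [p||A IHA B IHB|A IHA] //=;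
  try by case => /=; lia.
by case=> c; [have := IHA c | have := IHB c] => /=; lia.
Qed.

(** The next two lemmas identify both representations of the cut between [A]
    and [B] with the given decomposition of [A ⊗ B]. *)
Lemma split_equiv_inl (A B : obj) (c : cut A) :
  unital (cutR c) -> split_equiv (@cut_arr (A ⊗ B) (inl c)) (Id (A ⊗ B)).
Proof.
move=> x; have [u [v [iu [iv e]]]] := split_equiv_unital_right (iso_cut_arr c) x.
exists u, (Lunit B ∘ (v ⊗₁ Id B)); split; first exact: iu.
split; first exact: (iso_comp (iso_lunit B) (iso_tens iv (iso_id B))).
rewrite /= tens_comp_idr -cat_assoc; rw (symmetry (assoc_nat _ _ _)).
by rw (triangle _ _); rewrite -!tensl e runitVK tens_id.
Qed.

Lemma split_equiv_inr (A B : obj) (d : cut B) :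
  unital (cutL d) -> split_equiv (@cut_arr (A ⊗ B) (inr d)) (Id (A ⊗ B)).
Proof.
move=> x; have [u [v [iu [iv e]]]] := split_equiv_unital_left (iso_cut_arr d) x.
exists (Runit A ∘ (Id A ⊗₁ u)), v.
split; first exact: (iso_comp (iso_runit A) (iso_tens (iso_id A) iu)).
split; first exact: iv.
rewrite /= tens_comp_idl -triangle -!cat_assoc; rw (assoc_nat _ _ _).
rw (assocVK _ _ _); rewrite cat_idl -!tensr.
by rewrite e lunitVK tens_id.
Qed.

Lemma split_equiv_cut_tens (A B : obj) (c : cut A) (d : cut B) :
  unital (cutR c) -> unital (cutL d) ->
  split_equiv (@cut_arr (A ⊗ B) (inl c)) (@cut_arr (A ⊗ B) (inr d)).
Proof.
move=> xc xd; apply: (split_equiv_trans (split_equiv_inl B xc)).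
by apply: split_equiv_sym; exact: split_equiv_inr.
Qed.

(** Cuts in different factors of a tensor product can have the same weight on
    the left only if both are equivalent to the cut between the factors. *)
Lemma split_equiv_weight (A : obj) (c d : cut A) :
  weight (cutL c) = weight (cutL d) -> split_equiv (cut_arr c) (cut_arr d).
Proof.
elim: A c d => [p||A IHA B IHB|A IHA] /=.
- by case; case => //= _; exact: split_equiv_refl.
- by move=> _ _ _; exact: split_equiv_refl.
- case=> c [d|d].
  + move=> /IHA [u [v [iu [iv e]]]]; exists u, (v ⊗₁ Id B).
    split; first exact: iu. split; first exact: (iso_tens iv (iso_id B)).
    rewrite /=; rw (symmetry (assoc_nat _ _ _)).
    by rewrite -tensl e.
  + move=> e; apply: split_equiv_cut_tens; apply: weight0_unital;
    by have := weight_cut c; move: e; rewrite /weight /=; lia.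
  + move=> e; apply: split_equiv_sym; apply: split_equiv_cut_tens;
    apply: weight0_unital;
    by have := weight_cut d; move: e; rewrite /weight /=; lia.
  + move=> e.
    have /IHB [u [v [iu [iv {}e]]]] : weight (cutL c) = weight (cutL d).
      by move: e; rewrite /weight /=; lia.
    exists (Id A ⊗₁ u), v; split; first exact: (iso_tens (iso_id A) iu).
    split; first exact: iv.
    rewrite /=; rw (symmetry (assocV_nat _ _ _)).
    by rewrite -tensr e.
- case; case=> /= e; try exact: split_equiv_refl;
  by move: e; rewrite /weight /= ?addnS.
Qed.


(** Normal form of an arrow into [B ⊗ C]: the cut between [B] and [C] pulls
    back to the source. *)
Lemma arr_tensor (A B C : obj) (f : arr A (B ⊗ C)) :
  exists (c : cut A) (g : arr (cutL c) B) (h : arr (cutR c) C),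
    f ≡ (g ⊗₁ h) ∘ cut_arr c.
Proof.
have [d xd] := cut_right B.
have [u [v [_ [_ e]]]] := split_equiv_inl C xd.
have [c [g [h eg]]] := cut_nat f (inl d : cut (B ⊗ C)).
exists c, (u ∘ g), (v ∘ h).
by rewrite -tens_merge -cat_assoc -eg cat_assoc e cat_idl.
Qed.

(** * Reading the normal forms off from G *)

Lemma Gval_heq (A B : obj) (f g : arr A B) i :
  f ≡ g -> i < Gob A -> Gval f i = Gval g i.
Proof. by move=> e; move: i; apply/Garr_eqP; exact: Garr_heq. Qed.

Lemma Gob_cut (A : obj) (c : cut A) : Gob (cutR c) + Gob (cutL c) = Gob A.
Proof.
elim: A c => [p||A IHA B IHB|A IHA] //=; try by case => /=; lia.
by case=> c; [have := IHA c | have := IHB c] => /=; lia.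
Qed.

Lemma Gval_cut_arr (A : obj) (c : cut A) i :
  i < Gob A -> Gval (cut_arr c) i = i.
Proof.
elim: A c i => [p||A IHA B IHB|A IHA] //=; last by case.
case=> c i lti; have := Gob_cut c => /= e;
by case: ltnP => // leB; rewrite ?IHA ?IHB; lia.
Qed.

Lemma Gval_split (A B C : obj) (c : cut A) (g : arr (cutL c) B)
    (h : arr (cutR c) C) i : i < Gob A ->
  Gval ((g ⊗₁ h) ∘ cut_arr c) i =
    if i < Gob (cutR c) then Gval h i else Gob C + Gval g (i - Gob (cutR c)).
Proof. by move=> lti; rewrite /= Gval_cut_arr. Qed.

Lemma Gval_split_lt (A B C : obj) (c : cut A) (g : arr (cutL c) B)
    (h : arr (cutR c) C) i : i < Gob A ->
  (Gval ((g ⊗₁ h) ∘ cut_arr c) i < Gob C) = (i < Gob (cutR c)).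
Proof.
move=> lti; rewrite Gval_split //; case: (ltnP i (Gob (cutR c))) => [lt|le].
  by rewrite Gval_lt.
by apply/negbTE; rewrite -leqNgt leq_addr.
Qed.

Lemma addn_ltF m n : (m + n < m) = false.
Proof. by lia. Qed.

(** For an arrow into [B ⊗ C], the image under G tells which occurrences of T
    of the source go to [C], and the number of generators of the left factor
    is that of [B]. Hence the weight of the left factor, and so the cut,
    is determined; G of the two components is read off next. *)
Lemma faithful_tensor (A B C : obj) :
  (forall X (f g : arr X B), Garr f = Garr g -> f ≡ g) ->
  (forall X (f g : arr X C), Garr f = Garr g -> f ≡ g) ->
  forall f g : arr A (B ⊗ C), Garr f = Garr g -> f ≡ g.
Proof.
move=> IHB IHC f g; have [c [f1 [f2 ef]]] := arr_tensor f.
have [d [g1 [g2 eg]]] := arr_tensor g.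
move=> efg; have {}efg : Garr ((f1 ⊗₁ f2) ∘ cut_arr c) =
    Garr ((g1 ⊗₁ g2) ∘ cut_arr d).
  by rewrite -(Garr_heq ef) -(Garr_heq eg).
have eR : Gob (cutR c) = Gob (cutR d).
  have ec := Gob_cut c; have ed := Gob_cut d.
  move/Garr_eqP: (efg) => efgi.
  have same i : i < Gob A -> (i < Gob (cutR c)) = (i < Gob (cutR d)).
    move=> lti; rewrite -(Gval_split_lt f1 f2) //.
    by rewrite -(Gval_split_lt g1 g2) // efgi.
  case: (ltngtP (Gob (cutR c)) (Gob (cutR d))) => // lt.
    by have := same (Gob (cutR c)); rewrite ltnn lt; lia.
  by have := same (Gob (cutR d)); rewrite ltnn lt; lia.
have [u [v [_ [_ e]]]] : split_equiv (cut_arr c) (cut_arr d).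
  apply: split_equiv_weight; rewrite /weight (gens_arr f1) (gens_arr g1).
  by have := Gob_cut c; have := Gob_cut d; lia.
have {}eg : g ≡ ((g1 ∘ u) ⊗₁ (g2 ∘ v)) ∘ cut_arr c.
  by rewrite eg -e cat_assoc tens_merge.
have {}efg i : i < Gob A -> Gval ((f1 ⊗₁ f2) ∘ cut_arr c) i =
    Gval (((g1 ∘ u) ⊗₁ (g2 ∘ v)) ∘ cut_arr c) i.
  move: i; apply/Garr_eqP; rewrite efg; apply: Garr_heq.
  by rewrite -tens_merge -cat_assoc e.
have ec := Gob_cut c.
rewrite ef eg; apply: arr_comp => //; apply: arr_tens.
  apply: IHB; apply/Garr_eqP => i lti.
  have := efg (Gob (cutR c) + i); rewrite !Gval_split; try lia.
  rewrite addn_ltF addKn /= => e'; apply/(@addnI (Gob C))/e'; lia.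
apply: IHC; apply/Garr_eqP => i lti.
by have := efg i; rewrite !Gval_split ?lti; [apply; lia | lia | lia].
Qed.

Ltac split_ifs := repeat match goal with
  | |- context [if ?b then _ else _] =>
    lazymatch b with context [if _ then _ else _] => fail | _ => idtac end;
    let h := fresh "h" in case h : b
  end.

Lemma Gval_psi (A B : obj) i : i < (Gob B).+1 + (Gob A).+1 ->
  Gval (psi A B) i =
    if i < Gob B then i else
    if (i == Gob B) || (i == Gob B + (Gob A).+1) then Gob B + Gob A else i.-1.
Proof.
move=> lti; rewrite (Gval_heq (psi_def A B)) //=.
by split_ifs; lia.
Qed.

Fixpoint marked (A : obj) : marks A -> nat -> bool :=
  match A return marks A -> nat -> bool with
  | Gen _ | Unit => fun _ _ => false
  | Tensor A B => fun m i =>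
      if i < Gob B then marked m.2 i else marked m.1 (i - Gob B)
  | Tob A => fun m i =>
      if m is Some m' then (i == Gob A) || marked m' i else false
  end.

Lemma marks_eq (A : obj) (m n : marks A) :
  (forall i, i < Gob A -> marked m i = marked n i) -> m = n.
Proof.
elim: A m n => [p||A IHA B IHB|A IHA] /=; try by do 2 case.
- move=> [m1 m2] [n1 n2] /= e; congr (_, _).
    apply: IHA => i lti; have := e (Gob B + i).
    by rewrite addn_ltF addKn /=; apply; lia.
  by apply: IHB => i lti; have := e i; rewrite lti; apply; lia.
- move=> [m|] [n|] //= e.
  + congr Some; apply: IHA => i lti; have := e i.
    by rewrite (ltn_eqF lti) /=; apply; lia.
  + by have := e (Gob A) (ltnSn _); rewrite eqxx.
  + by have := e (Gob A) (ltnSn _); rewrite eqxx.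
Qed.

Lemma collect_top (A : obj) (m : marks A) i : i < Gob A ->
  (Gval (collect m) i == Gob (erase m)) = marked m i.
Proof.
elim: A m i => [p||A IHA B IHB|A IHA] //=.
- move=> [m n] i lti /=.
  case: (ltnP i (Gob B)) => [lt|le].
    have lti' := Gval_lt (collect n) lt; have e := IHB n i lt.
    rewrite Gval_psi -?e /=; last by move: lti' => /=; lia.
    by move: lti' => /=; split_ifs; lia.
  have lt : i - Gob B < Gob A by lia.
  have lti' := Gval_lt (collect m) lt; have e := IHA m _ lt.
  rewrite Gval_psi -?e /=; last by move: lti' => /=; lia.
  by move: lti' => /=; split_ifs; lia.
- move=> [m|] i lti /=; last by lia.
  case: (ltnP i (Gob A)) => [lt|le].
    have lti' := Gval_lt (collect m) lt; rewrite -IHA //.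
    by move: lti' => /=; split_ifs; lia.
  have -> : i = Gob A by lia.
  by rewrite eqxx /=; split_ifs; lia.
Qed.

Lemma collect_onto (A : obj) (m : marks A) j : j < Gob (erase m) ->
  exists2 i, i < Gob A & Gval (collect m) i = j.
Proof.
elim: A m j => [p||A IHA B IHB|A IHA] //=.
- move=> [m n] j /= ltj.
  case: (ltnP j (Gob (erase n))) => [lt|le].
    have [i lti e] := IHB n j lt; exists i; first by lia.
    by rewrite lti e Gval_psi ?lt //; lia.
  have [i lti e] := IHA m (j - Gob (erase n)) ltac:(lia).
  exists (Gob B + i); first by lia.
  rewrite addn_ltF addKn /= e Gval_psi; last by lia.
  by split_ifs; lia.
- move=> [m|] j /= ltj; last by exists j.
  have [i lti e] := IHA m j ltj; exists i; first by lia.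
  by rewrite lti e; split_ifs; lia.
Qed.

(** For an arrow into [T B], the marking consists of the occurrences of T sent
    to the greatest element, and [collect] reaches all the other elements, so
    that both parts of the normal form are determined. *)
Lemma faithful_T (A B : obj) :
  (forall X (f g : arr X B), Garr f = Garr g -> f ≡ g) ->
  forall f g : arr A (T B), Garr f = Garr g -> f ≡ g.
Proof.
move=> IHB f g; have [m [f' ef]] := factor_collect f.
have [n [g' eg]] := factor_collect g => efg.
have {}efg i : i < Gob A -> Gval (Tarr f' ∘ collect m) i =
    Gval (Tarr g' ∘ collect n) i.
  by move: i; apply/Garr_eqP; rewrite -(Garr_heq ef) -(Garr_heq eg).
have top (k : marks A) (h : arr (erase k) B) i : i < Gob A ->
    (Gval (Tarr h ∘ collect k) i == Gob B) = marked k i.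
  move=> lti; rewrite -collect_top //=.
  have := Gval_lt (collect k) lti => /= ltk.
  case: (ltnP (Gval (collect k) i) (Gob (erase k))) => [lt|le].
    by have := Gval_lt h lt; lia.
  by lia.
have e : m = n.
  by apply: marks_eq => i lti; rewrite -(top _ f') // -(top _ g') // efg.
case: _ / e g' eg efg => g' eg efg.
rewrite ef eg; apply: arr_comp => //; apply: arr_T; apply: IHB.
apply/Garr_eqP => j ltj; have [i lti ei] := collect_onto ltj.
by have := efg i lti; rewrite /= ei ltj.
Qed.

End Faithful.

Theorem mainTheorem3 (P : Type) : faithful (G P).
Proof.
move=> A B; elim: B A => [p||B IHB C IHC|B IHB] A f g.
- by move=> _; exact: arr_gen_eq.
- by move=> _; exact: arr_unit_eq.
- exact: faithful_tensor.
- exact: faithful_T.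
Qed.
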